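(* Let $u_{\rm cusp}$ be the cusped soliton, i.e. the function with $u_{\rm cusp}(0)=1$ and, for $x\neq0$, $u=u_{\rm cusp}(x)\in(0,1)$ defined by the implicit equation $$|x|=\int_{u}^1\frac{d\xi}{\sqrt{-\log(1-\xi^2)}},\qquad u\in(0,1).$$ Then $$u_{\rm cusp}(x)=1-|x|\sqrt{\log(1/|x|)}\left[1+\mathcal{O}\!\left(\frac{\log\log(1/|x|)}{\log(1/|x|)}\right)\right]\quad\text{as }|x|\to0,$$ where $\mathcal{O}(v)$ denotes a $C^1$ function of $v$ near $v=0^+$.
   Context: The function $u_{\rm cusp}$ is a solution of $u''=u/(1-u^2)$ for $x\ne 0$, on the zero level of the invariant $\frac12(u')^2+\frac12\log|1-u^2|$. As usual, the term $\mathcal{O}(v)$ is bounded by a constant multiple of $v$ as $v\to0^+$. *)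

(* Defs.v *)
From Stdlib Require Import Reals.
From Coquelicot Require Import Coquelicot.
Open Scope R_scope.

(* At the endpoint xi = 1 the value used for [ln 0] is immaterial: it affects
   the integrand at a single point, and the integrand tends to 0 there. *)
Definition cusped_soliton (u : R -> R) : Prop :=
  u 0 = 1 /\
  forall x : R, x <> 0 ->
    0 < u x < 1 /\
    is_RInt (fun xi : R => 1 / sqrt (- ln (1 - xi ^ 2))) (u x) 1 (Rabs x).

(* Derivative and continuity are relative to [D], hence one-sided at an
   endpoint of an interval. *)
Definition C1_on (D : R -> Prop) (f : R -> R) : Prop :=
  exists df : R -> R,
    forall v : R, D v -> D_in f df D v /\ continue_in df D v.

(* [f] is a term O(v): C^1 on some [0, delta), the endpoint 0 included, and
   bounded there by a constant multiple of v. *)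
Definition C1_bigO_0plus (f : R -> R) : Prop :=
  exists delta : R, 0 < delta /\
    C1_on (fun v : R => 0 <= v < delta) f /\
    exists C : R, forall v : R, 0 < v < delta -> Rabs (f v) <= C * v.

(* Main.v *)
(** Put w = 1 - u, so that |x| = G(w) with G' = k = (- ln (w (2 - w)))^(-1/2)
    and G(0) = 0.  With L = - ln G(w), both the variable v = ln L / L and the
    correction w / (|x| sqrt L) - 1 are explicit functions of w, and f is the
    second one reparametrized by the first; f is C^1 up to v = 0 as soon as the
    quotient of the two derivatives has a limit at w = 0+.  Differentiating
    the expansion w k (1 - k^2 / 2 + a k^4) gives
    G = w k (1 - k^2 / 2 + O(k^4)), precise enough to survive the
    cancellations in that quotient, whose limit is -1/4. *)
Require Import Defs.
From Stdlib Require Import Reals Lra ClassicalEpsilon Ranalysis5.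
From Coquelicot Require Import Coquelicot.
Open Scope R_scope.

(** * C^1 reparametrization up to an endpoint *)

(** With the derivative of [Phi] factored as [q * dV], the positive factor [dV z] cancels and only
    the quotient [q] survives. Taking the identity for [V] gives back the ordinary mean value
    theorem. *)
Lemma cauchy_mean_value (V Phi q dV : R -> R) (a b : R) :
  a < b ->
  (forall w, a <= w <= b -> continuous V w) ->
  (forall w, a <= w <= b -> continuous Phi w) ->
  (forall w, a < w < b ->
     is_derive V w (dV w) /\ 0 < dV w /\ is_derive Phi w (q w * dV w)) ->
  exists z, a < z < b /\ Phi b - Phi a = q z * (V b - V a).
Proof.
  intros Hab HV HPhi Hd.
  destruct (MVT V Phi a b
    (fun w Hw => exist (derivable_pt_abs V w) (dV w) (proj1 (is_derive_Reals _ _ _) (proj1 (Hd w Hw))))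
    (fun w Hw => exist (derivable_pt_abs Phi w) (q w * dV w)
       (proj1 (is_derive_Reals _ _ _) (proj2 (proj2 (Hd w Hw))))))
    as [z [Hz Heq]]; trivial.
  - intros w Hw; apply continuity_pt_filterlim; now apply HV.
  - intros w Hw; apply continuity_pt_filterlim; now apply HPhi.
  - exists z; split; [exact Hz|].
    unfold derive_pt in Heq; simpl in Heq.
    assert (Hpos := proj1 (proj2 (Hd z Hz))).
    apply Rmult_eq_reg_r with (dV z); lra.
Qed.

(* With [W] an inverse of [V], Cauchy's mean value theorem turns every difference
   quotient of [Phi o W] into a value of [q] at an intermediate point, so the
   derivative is [q o W], at the endpoint [0] as well. *)
Lemma C1_reparametrization_closed (V Phi q dV : R -> R) (w0 : R) :
  0 < w0 -> V 0 = 0 -> Phi 0 = 0 ->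
  (forall w, w < w0 -> continuous V w) ->
  (forall w, w < w0 -> continuous Phi w) ->
  (forall w, w < w0 -> continuous q w) ->
  (forall w, 0 < w < w0 ->
     is_derive V w (dV w) /\ 0 < dV w /\ is_derive Phi w (q w * dV w)) ->
  exists f, C1_bigO_0plus f /\
    exists w1, 0 < w1 /\ forall w, 0 < w < w1 -> f (V w) = Phi w.
Proof.
  intros Hw0 HV0 HPhi0 HV HPhi Hq Hd.
  assert (Hinc : forall a b, 0 <= a -> a < b -> b < w0 -> V a < V b).
  { intros a b Ha Hab Hb.
    destruct (cauchy_mean_value (fun w => w) V dV (fun _ => 1) a b)
      as [z [Hz Heq]]; trivial.
    - intros w _; apply continuous_id.
    - intros w Hw; apply HV; lra.
    - intros w Hw; destruct (Hd w) as [H1 _]; [lra|].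
      rewrite Rmult_1_r; split; [apply (is_derive_id (K := R_AbsRing))|].
      split; [lra|exact H1].
    - destruct (Hd z) as [_ [Hpos _]]; [lra|].
      assert (0 < dV z * (b - a)) by (apply Rmult_lt_0_compat; lra); lra. }
  assert (Hle : forall a b, 0 <= a < w0 -> 0 <= b < w0 -> V a < V b -> a < b).
  { intros a b Ha Hb H; destruct (Rtotal_order a b) as [Hl|[->|Hl]]; [lra|lra|].
    apply Hinc in Hl; lra. }
  (* Halving leaves room: a point of [0, w1] increased by at most w0 / 4 stays below w0. *)
  pose (w1 := w0 / 2).
  (* The inverse is chosen pointwise among the preimages given by the intermediate value theorem on
     [0, w1]. *)
  assert (HW : exists W, forall v, 0 <= v <= V w1 -> 0 <= W v <= w1 /\ V (W v) = v).
  { exists (fun v => epsilon (inhabits 0) (fun w => 0 <= w <= w1 /\ V w = v)).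
    intros v Hv; apply epsilon_spec.
    destruct (f_interv_is_interv V 0 w1 v) as [w Hw];
      [unfold w1; lra|lra| |now exists w].
    intros w Hw; apply continuity_pt_filterlim, HV; unfold w1 in Hw; lra. }
  destruct HW as [W HW].
  assert (Hd1 : 0 < V w1) by (rewrite <- HV0; apply Hinc; unfold w1; lra).
  assert (HW0 : W 0 = 0).
  { destruct (HW 0) as [H1 H2]; [lra|].
    destruct (Rle_lt_or_eq_dec 0 (W 0)) as [H|H]; [lra| |easy].
    unfold w1 in H1; apply Hinc in H; lra. }
  assert (Hmv : forall v v', 0 <= v < V w1 -> 0 <= v' < V w1 -> v <> v' ->
    exists z, Rmin (W v) (W v') <= z <= Rmax (W v) (W v') /\
      Phi (W v') - Phi (W v) = q z * (v' - v)).
  { assert (Hmv : forall v v', 0 <= v -> v' < V w1 -> v < v' ->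
      exists z, W v <= z <= W v' /\ Phi (W v') - Phi (W v) = q z * (v' - v)).
    { intros v v' H1 H2 H3.
      destruct (HW v) as [H4 H5]; [lra|]; destruct (HW v') as [H6 H7]; [lra|].
      unfold w1 in H4, H6.
      assert (W v < W v') by (apply Hle; lra).
      destruct (cauchy_mean_value V Phi q dV (W v) (W v')) as [z [Hz Heq]];
        [easy|intros; apply HV; lra|intros; apply HPhi; lra|
         intros; apply Hd; lra|].
      exists z; split; [lra|]; rewrite Heq; congruence. }
    intros v v' H1 H2 H3.
    destruct (Rtotal_order v v') as [H|[H|H]]; [|easy|].
    - destruct (Hmv v v') as [z [H4 H5]]; try lra.
      exists z; rewrite Rmin_left, Rmax_right by lra; easy.
    - destruct (Hmv v' v) as [z [H4 H5]]; try lra.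
      exists z; rewrite Rmin_right, Rmax_left by lra; split; [easy|lra]. }
  (* One estimate serves twice: an intermediate [z] from [Hmv] gives the derivative of [Phi] o [W],
     and [z = W v'] gives the continuity of [q] o [W]. *)
  assert (Hcont : forall v eps, 0 <= v < V w1 -> 0 < eps -> exists eta, 0 < eta /\
    forall v', 0 <= v' < V w1 -> Rabs (v' - v) < eta ->
    forall z, Rmin (W v) (W v') <= z <= Rmax (W v) (W v') ->
      Rabs (q z - q (W v)) < eps).
  { intros v eps Hv Heps.
    destruct (HW v) as [H1 H2]; [lra|]; unfold w1 in H1.
    assert (HqW : continuous q (W v)) by (apply Hq; lra).
    destruct (proj1 (filterlim_locally (F := locally (W v)) q (q (W v))) HqW
      (mkposreal eps Heps)) as [d Hdq].
    pose (e := Rmin d (w0 / 4)).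
    assert (He : 0 < e <= d /\ e <= w0 / 4).
    { unfold e; generalize (cond_pos d) (Rmin_l d (w0 / 4)) (Rmin_r d (w0 / 4)).
      intros; repeat split; try easy; apply Rmin_glb_lt; lra. }
    assert (Hp : v < V (W v + e)) by (rewrite <- H2 at 1; apply Hinc; lra).
    (* If [W v - e] is negative the lower bound is automatic, since [W v'] is nonnegative, and any
       positive [m] will do. *)
    assert (Hm : exists m, 0 < m /\ forall v', 0 <= v' < V w1 ->
      v - v' < m -> W v - e < W v').
    { destruct (Rlt_le_dec (W v - e) 0).
      - exists 1; split; [lra|]; intros v' Hv' _.
        destruct (HW v'); lra.
      - assert (V (W v - e) < v) by (rewrite <- H2 at 2; apply Hinc; lra).
        exists (v - V (W v - e)); split; [lra|]; intros v' Hv' H3.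
        destruct (HW v') as [H4 H5]; [lra|]; unfold w1 in H4; apply Hle; lra. }
    destruct Hm as [m [Hm0 Hm]].
    exists (Rmin m (V (W v + e) - v)); split; [apply Rmin_glb_lt; lra|].
    intros v' Hv' Hvv z Hz.
    generalize (Rmin_l m (V (W v + e) - v)) (Rmin_r m (V (W v + e) - v)).
    intros Hr1 Hr2.
    apply Rabs_lt_between' in Hvv.
    destruct (HW v') as [H4 H5]; [lra|]; unfold w1 in H4.
    assert (W v' < W v + e) by (apply Hle; lra).
    assert (W v - e < W v') by (apply Hm; lra).
    apply (Hdq z); apply Rabs_lt_between'.
    revert Hz; unfold Rmin, Rmax; destruct (Rle_dec (W v) (W v')); lra. }
  exists (fun v => Phi (W v)); split.
  - exists (V w1); split; [easy|]; split.
    + exists (fun v => q (W v)); intros v Hv; split; intros eps Heps;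
        destruct (Hcont v eps Hv Heps) as [eta [Heta Hc]];
        exists eta; (split; [easy|]); intros v' [[Hv' Hne] Hdist].
      * destruct (Hmv v v' Hv Hv' Hne) as [z [Hz Heq]].
        simpl; unfold R_dist, Rdist in *.
        rewrite Heq.
        replace (q z * (v' - v) / (v' - v)) with (q z) by (field; lra).
        now apply (Hc v').
      * apply (Hc v'); trivial; split; [apply Rmin_r|apply Rmax_r].
    (* The constant of the O(v) bound is the maximum of |q| on [0, w1]. *)
    + destruct (continuity_ab_maj (fun w => Rabs (q w)) 0 w1) as [M [HM _]].
      * unfold w1; lra.
      * intros w Hw; apply continuity_pt_filterlim.
        apply (continuous_comp q Rabs); [apply Hq; unfold w1 in Hw; lra|].
        apply continuous_Rabs.
      * exists (Rabs (q M)); intros v Hv.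
        destruct (Hmv 0 v) as [z [Hz Heq]]; try lra.
        destruct (HW v) as [H1 H2]; [lra|].
        rewrite HW0 in *; rewrite Rmin_left, Rmax_right in Hz by lra.
        rewrite HPhi0, !Rminus_0_r in Heq; rewrite Heq, Rabs_mult.
        rewrite (Rabs_right v) by lra.
        apply Rmult_le_compat_r; [lra|]; apply HM; lra.
  - exists w1; split; [unfold w1; lra|]; intros w Hw.
    assert (V w < V w1) by (apply Hinc; unfold w1 in *; lra).
    assert (V 0 < V w) by (apply Hinc; unfold w1 in *; lra).
    destruct (HW (V w)) as [H1 H2]; [lra|].
    f_equal; unfold w1 in *.
    destruct (Rtotal_order (W (V w)) w) as [Hl|[Hl|Hl]]; trivial;
      apply Hinc in Hl; lra.
Qed.

(** The one-sided limits at 0 allow [V], [Phi] and [q] to be extended continuously to w <= 0. This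
    is why the closed version assumes continuity at every w < w0. *)
Lemma C1_reparametrization (V Phi q dV : R -> R) (c w0 : R) :
  0 < w0 ->
  filterlim V (at_right 0) (locally 0) ->
  filterlim Phi (at_right 0) (locally 0) ->
  filterlim q (at_right 0) (locally c) ->
  (forall w, 0 < w < w0 ->
     is_derive V w (dV w) /\ 0 < dV w /\ is_derive Phi w (q w * dV w) /\
     continuous q w) ->
  exists f, C1_bigO_0plus f /\
    exists w1, 0 < w1 /\ forall w, 0 < w < w1 -> f (V w) = Phi w.
Proof.
  intros Hw0 HV HPhi Hq Hd.
  destruct (C0_extension_left V 0 0 w0) as [Ve [HV1 [HV2 HV3]]]; trivial.
  { intros w Hw; apply (ex_derive_continuous V); exists (dV w); now apply Hd. }
  destruct (C0_extension_left Phi 0 0 w0) as [Pe [HP1 [HP2 HP3]]]; trivial.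
  { intros w Hw; apply (ex_derive_continuous Phi); exists (q w * dV w); now apply Hd. }
  destruct (C0_extension_left q c 0 w0) as [qe [Hq1 [Hq2 Hq3]]]; trivial.
  { intros w Hw; now apply Hd. }
  assert (Hloc : forall (g h : R -> R) w, (forall z, 0 < z -> g z = h z) ->
    0 < w -> locally w (fun z => h z = g z)).
  { intros g h w H Hw; exists (mkposreal w Hw); intros z Hz.
    apply Rabs_lt_between' in Hz; simpl in Hz; symmetry; apply H; lra. }
  destruct (C1_reparametrization_closed Ve Pe qe dV w0) as [f [Hf [w1 [Hw1 H]]]];
    trivial.
  - intros w Hw; destruct (Hd w Hw) as [H1 [H2 [H3 _]]]; split; [|split; [exact H2|]].
    + apply is_derive_ext_loc with V; [apply Hloc; [exact HV2|lra]|exact H1].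
    + rewrite Hq2 by lra.
      apply is_derive_ext_loc with Phi; [apply Hloc; [exact HP2|lra]|exact H3].
  - exists f; split; [exact Hf|]; exists w1; split; [exact Hw1|].
    intros w Hw; rewrite <- HV2, <- HP2 by lra; now apply H.
Qed.

(** * The arc length integral near the cusp *)

(* The integrand in the variable [w = 1 - xi]. *)
Definition cusp_weight (w : R) : R := 1 / sqrt (- ln (1 - (1 - w) ^ 2)).

Definition cusp_length (w : R) : R := RInt cusp_weight 0 w.

Lemma ln_nonpos_eq (x : R) : x <= 0 -> ln x = 0.
Proof. intros Hx; unfold ln; destruct (Rlt_dec 0 x); [exfalso; lra|reflexivity]. Qed.

Lemma one_minus_sqr_bounds (w : R) : 0 < w < 1 -> w < 1 - (1 - w) ^ 2 < 1.
Proof. intros Hw; split; nra. Qed.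

Lemma neg_ln_pos (w : R) : 0 < w < 1 -> 0 < - ln (1 - (1 - w) ^ 2).
Proof.
  intros Hw; destruct (one_minus_sqr_bounds w Hw) as [H1 H2].
  apply ln_increasing in H2; [|lra].
  rewrite ln_1 in H2; lra.
Qed.

Lemma cusp_weight_nonpos (w : R) : w <= 0 -> cusp_weight w = 0.
Proof.
  intros Hw; unfold cusp_weight.
  rewrite ln_nonpos_eq by (simpl; nra).
  rewrite Ropp_0, sqrt_0; unfold Rdiv; rewrite Rinv_0; ring.
Qed.

Lemma cusp_weight_pos (w : R) : 0 < w < 1 -> 0 < cusp_weight w.
Proof.
  intros Hw; unfold cusp_weight.
  apply Rdiv_lt_0_compat; [lra|]; apply sqrt_lt_R0; now apply neg_ln_pos.
Qed.

Lemma cusp_weight_sqr (w : R) :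
  0 < w < 1 -> cusp_weight w ^ 2 = / - ln (1 - (1 - w) ^ 2).
Proof.
  intros Hw; assert (HP := neg_ln_pos w Hw); unfold cusp_weight.
  assert (Hs := sqrt_lt_R0 _ HP).
  rewrite <- (pow2_sqrt (- ln (1 - (1 - w) ^ 2))) at 2 by lra; field; lra.
Qed.

Lemma cusp_weight_derive (w : R) :
  0 < w < 1 ->
  is_derive cusp_weight w ((1 - w) / (w * (2 - w)) * cusp_weight w ^ 3).
Proof.
  intros Hw; assert (HP := neg_ln_pos w Hw).
  destruct (one_minus_sqr_bounds w Hw) as [H1 H2].
  assert (Hs := sqrt_lt_R0 _ HP).
  unfold cusp_weight; auto_derive.
  - replace (1 + - ((1 + - w) * ((1 + - w) * 1))) with (1 - (1 - w) ^ 2) by ring.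
    repeat split; lra.
  - replace (1 + - ((1 + - w) * ((1 + - w) * 1))) with (1 - (1 - w) ^ 2) by ring.
    replace (1 - (1 - w) ^ 2) with (w * (2 - w)) in * by ring.
    set (s := sqrt _) in *.
    replace (1 + - w) with (1 - w) by ring.
    field; repeat split; try lra; nra.
Qed.

(* Junk values help here: [ln] is [0] on nonpositive numbers and [/ 0 = 0], so
   [cusp_weight] vanishes on [w <= 0] and is continuous across the endpoint. *)
Lemma cusp_weight_continuous (w : R) : w < 1 -> continuous cusp_weight w.
Proof.
  intros Hw; destruct (Rlt_le_dec 0 w) as [Hpos|Hneg].
  - apply (ex_derive_continuous cusp_weight).
    eexists; apply cusp_weight_derive; lra.
  - apply (proj2 (filterlim_locally (F := locally w) cusp_weight (cusp_weight w))).
    intros eps; assert (Heps := cond_pos eps).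
    (* This threshold makes 1 - (1 - z)^2 < 2 z <= e, hence - ln (1 - (1 - z)^2) > 1 / eps^2, that
       is, a weight below eps. The minimum with 1 keeps z < 1. *)
    pose (e := exp (- / eps ^ 2)).
    assert (He : 0 < Rmin 1 (e / 2)).
    { apply Rmin_glb_lt; [lra|]; generalize (exp_pos (- / eps ^ 2)); fold e; lra. }
    exists (mkposreal _ He); intros z Hz.
    apply Rabs_lt_between' in Hz; simpl in Hz.
    apply Rabs_lt_between'.
    generalize (Rmin_l 1 (e / 2)) (Rmin_r 1 (e / 2)).
    intros Hr1 Hr2; rewrite (cusp_weight_nonpos w Hneg).
    destruct (Rlt_le_dec 0 z) as [Hz0|Hz0];
      [|rewrite (cusp_weight_nonpos z Hz0); lra].
    assert (Hz1 : 0 < z < 1) by lra.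
    assert (Hk := cusp_weight_pos z Hz1); split; [lra|].
    destruct (one_minus_sqr_bounds z Hz1) as [H1 H2].
    assert (HP : / eps ^ 2 < - ln (1 - (1 - z) ^ 2)).
    { assert (ln (1 - (1 - z) ^ 2) < - / eps ^ 2); [|lra].
      rewrite <- (ln_exp (- / eps ^ 2)).
      apply ln_increasing; [lra|].
      apply Rlt_le_trans with (2 * z); [nra|fold e; lra]. }
    rewrite Rplus_0_l; apply Rsqr_incrst_0; try lra.
    rewrite !Rsqr_pow2, cusp_weight_sqr by easy.
    assert (0 < eps ^ 2) by (apply pow_lt; lra).
    rewrite <- (Rinv_inv (eps ^ 2)).
    apply Rinv_lt_contravar; [|exact HP].
    apply Rmult_lt_0_compat; [now apply Rinv_0_lt_compat|].
    now apply neg_ln_pos.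
Qed.

Lemma cusp_weight_ex_RInt (a b : R) : a < 1 -> b < 1 -> ex_RInt cusp_weight a b.
Proof.
  intros Ha Hb; apply (ex_RInt_continuous cusp_weight); intros z Hz.
  apply cusp_weight_continuous.
  revert Hz; unfold Rmax; destruct (Rle_dec a b); lra.
Qed.

Lemma cusp_length_0 : cusp_length 0 = 0.
Proof. apply (RInt_point 0 cusp_weight). Qed.

Lemma cusp_length_derive (w : R) :
  w < 1 -> is_derive cusp_length w (cusp_weight w).
Proof.
  intros Hw; apply (is_derive_RInt cusp_weight cusp_length 0 w);
    [|now apply cusp_weight_continuous].
  assert (Hd : 0 < 1 - w) by lra.
  exists (mkposreal _ Hd); intros z Hz.
  apply Rabs_lt_between' in Hz; simpl in Hz.
  apply (RInt_correct cusp_weight); apply cusp_weight_ex_RInt; lra.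
Qed.

(** The substitution xi = 1 - w moves the endpoint 1 to 0, where [cusp_weight] is continuous. It
    reverses the orientation, which accounts for the swap and the sign changes. *)
Lemma cusped_soliton_length (u : R -> R) (x : R) :
  cusped_soliton u -> x <> 0 ->
  0 < 1 - u x < 1 /\ Rabs x = cusp_length (1 - u x).
Proof.
  intros [_ Hu] Hx; destruct (Hu x Hx) as [Hux Hint]; split; [lra|].
  assert (H : is_RInt cusp_weight (-1 * u x + 1) (-1 * 1 + 1)
    (- cusp_length (1 - u x))).
  { replace (-1 * 1 + 1) with 0 by ring; replace (-1 * u x + 1) with (1 - u x) by ring.
    apply (is_RInt_swap cusp_weight).
    apply (RInt_correct cusp_weight); apply cusp_weight_ex_RInt; lra. }
  apply is_RInt_comp_lin, is_RInt_opp in H.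
  rewrite <- (is_RInt_unique _ _ _ _ Hint).
  rewrite <- (Ropp_involutive (cusp_length (1 - u x))).
  apply is_RInt_unique; revert H; apply is_RInt_ext.
  intros z _; unfold cusp_weight, opp, scal; simpl; unfold mult; simpl.
  replace (1 - (-1 * z + 1)) with z by ring; ring.
Qed.

(** * Two-sided expansion of the arc length *)

Lemma nonneg_of_derive_nonneg (f df : R -> R) (b : R) :
  f 0 = 0 ->
  (forall w, w < b -> continuous f w) ->
  (forall w, 0 < w < b -> is_derive f w (df w) /\ 0 <= df w) ->
  forall w, 0 < w < b -> 0 <= f w.
Proof.
  intros Hf0 Hc Hd w Hw.
  destruct (cauchy_mean_value (fun z => z) f df (fun _ => 1) 0 w) as [z [Hz Heq]];
    [lra|intros; apply continuous_id|intros; apply Hc; lra| |].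
  - intros z Hz; destruct (Hd z) as [H1 _]; [lra|].
    rewrite Rmult_1_r; split; [apply (is_derive_id (K := R_AbsRing))|].
    split; [lra|exact H1].
  - destruct (Hd z) as [_ H2]; [lra|].
    assert (0 <= df z * (w - 0)) by (apply Rmult_le_pos; lra); lra.
Qed.

(** With t the negated logarithm, w < exp (- t), and 2 t <= (1 + t / 2)^2 <= exp t, so w t <= t exp
    (- t) <= 1 / 2. *)
Lemma mul_neg_ln_le (w : R) : 0 < w < 1 -> w * - ln (1 - (1 - w) ^ 2) <= 1 / 2.
Proof.
  intros Hw; destruct (one_minus_sqr_bounds w Hw) as [H1 H2].
  set (t := - ln (1 - (1 - w) ^ 2)).
  assert (Ht : 0 < t) by now apply neg_ln_pos.
  assert (He : w * exp t < 1).
  { unfold t; rewrite exp_Ropp, exp_ln by lra.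
    apply Rmult_lt_reg_r with (1 - (1 - w) ^ 2); [lra|].
    field_simplify; lra. }
  assert (Hh : exp t = exp (t / 2) * exp (t / 2)) by (rewrite <- exp_plus; f_equal; field).
  assert (Hi := exp_ineq1_le (t / 2)).
  assert (Hq : (1 + t / 2) * (1 + t / 2) <= exp (t / 2) * exp (t / 2))
    by (apply Rmult_le_compat; lra).
  assert (Hsq := pow2_ge_0 (1 - t / 2)).
  assert (2 * t <= exp t) by (rewrite Hh; lra).
  nra.
Qed.

Lemma cusp_weight_sqr_ge (w : R) : 0 < w < 1 -> 2 * w <= cusp_weight w ^ 2.
Proof.
  intros Hw; rewrite cusp_weight_sqr by easy.
  assert (HP := neg_ln_pos w Hw); assert (H := mul_neg_ln_le w Hw).
  apply Rmult_le_reg_r with (- ln (1 - (1 - w) ^ 2)); [lra|].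
  rewrite Rinv_l; lra.
Qed.

(** The last coefficient is left free: a = 0 gives a lower bound for [cusp_length] and a = 1 an
    upper bound. *)
Definition cusp_expansion (a w : R) : R :=
  w * cusp_weight w * (1 - cusp_weight w ^ 2 / 2 + a * cusp_weight w ^ 4).

Lemma cusp_expansion_0 (a : R) : cusp_expansion a 0 = 0.
Proof. unfold cusp_expansion; ring. Qed.

Lemma cusp_expansion_continuous (a w : R) :
  w < 1 -> continuous (cusp_expansion a) w.
Proof.
  intros Hw; apply continuous_ext with
    (fun z => mult z (cusp_weight z *
       (1 - cusp_weight z ^ 2 / 2 + a * cusp_weight z ^ 4))).
  { intros z; unfold cusp_expansion, mult; simpl; ring. }
  apply (continuous_mult (K := R_AbsRing) (fun z => z)); [apply continuous_id|].
  apply (continuous_comp cusp_weight (fun k => k * (1 - k ^ 2 / 2 + a * k ^ 4)));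
    [now apply cusp_weight_continuous|].
  apply (ex_derive_continuous (fun k => k * (1 - k ^ 2 / 2 + a * k ^ 4))).
  auto_derive; trivial.
Qed.

(** The coefficient -1/2 is what nearly kills the cubic term: (1 - w) / (2 - w) - 1 / 2 = - w / (2
    (2 - w)) is of order w. *)
Lemma cusp_expansion_derive (a w : R) :
  0 < w < 1 ->
  is_derive (cusp_expansion a) w
    (cusp_weight w - w / (2 * (2 - w)) * cusp_weight w ^ 3 +
     (a - 3 / 2 * ((1 - w) / (2 - w))) * cusp_weight w ^ 5 +
     5 * a * ((1 - w) / (2 - w)) * cusp_weight w ^ 7).
Proof.
  intros Hw; assert (Hk := cusp_weight_derive w Hw).
  assert (He : ex_derive cusp_weight w) by (eexists; exact Hk).
  unfold cusp_expansion; auto_derive; [now repeat (split; trivial)|].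
  replace (Derive _ w) with ((1 - w) / (w * (2 - w)) * cusp_weight w ^ 3)
    by (symmetry; now apply is_derive_unique).
  field; lra.
Qed.

Lemma cusp_length_continuous (w : R) : w < 1 -> continuous cusp_length w.
Proof.
  intros Hw; apply (ex_derive_continuous cusp_length).
  eexists; now apply cusp_length_derive.
Qed.

(** For a = 0 the k^7 term vanishes and the two remaining error terms have the same sign. *)
Lemma cusp_length_ge (w : R) : 0 < w < 1 -> cusp_expansion 0 w <= cusp_length w.
Proof.
  intros Hw; apply Rge_le, Rminus_ge, Rle_ge; revert w Hw.
  apply (nonneg_of_derive_nonneg (fun w => cusp_length w - cusp_expansion 0 w)
    (fun w => w / (2 * (2 - w)) * cusp_weight w ^ 3 +
       3 / 2 * ((1 - w) / (2 - w)) * cusp_weight w ^ 5)).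
  - rewrite cusp_length_0, cusp_expansion_0; ring.
  - intros w Hw; apply (continuous_minus cusp_length (cusp_expansion 0));
      [now apply cusp_length_continuous|now apply cusp_expansion_continuous].
  - intros w Hw; assert (Hk := cusp_weight_pos w Hw); split.
    + evar_last; [apply (is_derive_minus cusp_length (cusp_expansion 0));
        [apply cusp_length_derive; lra|now apply cusp_expansion_derive]|].
      unfold minus, plus, opp; simpl; field; lra.
    + apply Rplus_le_le_0_compat; apply Rmult_le_pos; try (apply pow_le; lra).
      * apply Rdiv_le_0_compat; lra.
      * apply Rmult_le_pos; [lra|]; apply Rdiv_le_0_compat; lra.
Qed.

(* The error term [- w / (2 (2 - w)) k ^ 3] of the derivative is absorbed by
   [k ^ 5] thanks to [2 w <= k ^ 2]. *)
Lemma cusp_length_le (w : R) : 0 < w < 1 -> cusp_length w <= cusp_expansion 1 w.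
Proof.
  intros Hw; apply Rge_le, Rminus_ge, Rle_ge; revert w Hw.
  apply (nonneg_of_derive_nonneg (fun w => cusp_expansion 1 w - cusp_length w)
    (fun w => cusp_weight w ^ 3 * (- (w / (2 * (2 - w))) +
      (1 - 3 / 2 * ((1 - w) / (2 - w))) * cusp_weight w ^ 2 +
       5 * ((1 - w) / (2 - w)) * cusp_weight w ^ 4))).
  - rewrite cusp_length_0, cusp_expansion_0; ring.
  - intros w Hw; apply (continuous_minus (cusp_expansion 1) cusp_length);
      [now apply cusp_expansion_continuous|now apply cusp_length_continuous].
  - intros w Hw; assert (Hk := cusp_weight_pos w Hw); split.
    + evar_last; [apply (is_derive_minus (cusp_expansion 1) cusp_length);
        [now apply cusp_expansion_derive|apply cusp_length_derive; lra]|].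
      unfold minus, plus, opp; simpl; field; lra.
    + assert (Hge := cusp_weight_sqr_ge w Hw).
      apply Rmult_le_pos; [apply pow_le; lra|].
      apply Rplus_le_le_0_compat.
      (* With r = 1 / (2 - w) in (1/2, 1), the coefficient of k^2 is (3 r - 1) / 2 >= 1 / 4, while
         the negative term is r w / 2 <= w / 2 <= k^2 / 4. *)
      * assert (H1 : 1 / (2 - w) < 1) by (apply Rlt_div_l; lra).
        assert (H2 : (1 - w) / (2 - w) = 1 - 1 / (2 - w)) by (field; lra).
        assert (H3 : 1 / 2 < 1 / (2 - w)).
        { apply Rmult_lt_reg_r with (2 - w); [lra|]; field_simplify; lra. }
        replace (w / (2 * (2 - w))) with (1 / (2 - w) * (w / 2)) by (field; lra).
        rewrite H2; set (r := 1 / (2 - w)) in *.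
        assert (0 <= (1 - r) * w) by (apply Rmult_le_pos; lra).
        assert (0 <= (r - 1 / 2) * cusp_weight w ^ 2)
          by (apply Rmult_le_pos; [lra|apply pow2_ge_0]).
        lra.
      * apply Rmult_le_pos; [|apply pow_le; lra].
        apply Rmult_le_pos; [lra|]; apply Rdiv_le_0_compat; lra.
Qed.

Lemma cusp_length_increasing (a b : R) :
  0 <= a -> a < b -> b < 1 -> cusp_length a < cusp_length b.
Proof.
  intros Ha Hab Hb.
  destruct (cauchy_mean_value (fun z => z) cusp_length cusp_weight (fun _ => 1) a b)
    as [z [Hz Heq]];
    [lra|intros; apply continuous_id|intros; apply cusp_length_continuous; lra| |].
  - intros z Hz; rewrite Rmult_1_r.
    split; [apply (is_derive_id (K := R_AbsRing))|].
    split; [lra|apply cusp_length_derive; lra].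
  - assert (Hk : 0 < cusp_weight z) by (apply cusp_weight_pos; lra).
    assert (0 < cusp_weight z * (b - a)) by (apply Rmult_lt_0_compat; lra); lra.
Qed.

Lemma cusp_length_pos (w : R) : 0 < w < 1 -> 0 < cusp_length w.
Proof. intros Hw; rewrite <- cusp_length_0; apply cusp_length_increasing; lra. Qed.

Definition cusp_log (w : R) : R := - ln (cusp_length w).

(** The bound 3 exceeds e, so ln L > 1 and L -> ln L / L is strictly decreasing there. This makes
    the derivative of [cusp_variable] positive. *)
Lemma cusp_log_large :
  exists w0, 0 < w0 < 1 /\ forall w, 0 < w < w0 -> 3 < cusp_log w.
Proof.
  assert (HG : continuous cusp_length 0) by (apply cusp_length_continuous; lra).
  destruct (proj1 (filterlim_locally (F := locally 0) cusp_length (cusp_length 0)) HG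
    (mkposreal _ (exp_pos (-3)))) as [d Hd].
  assert (Hpos := cond_pos d).
  exists (Rmin d (1 / 2)); generalize (Rmin_l d (1 / 2)) (Rmin_r d (1 / 2)).
  intros H1 H2; split; [split; [apply Rmin_glb_lt; lra|lra]|].
  intros w Hw.
  assert (Hb : ball 0 d w) by (apply Rabs_lt_between'; lra).
  specialize (Hd w Hb); apply Rabs_lt_between' in Hd.
  rewrite cusp_length_0 in Hd.
  unfold cusp_log; assert (ln (cusp_length w) < -3); [|lra].
  rewrite <- (ln_exp (-3)); apply ln_increasing; [apply cusp_length_pos; lra|].
  simpl in Hd; lra.
Qed.

(** * Limits at the cusp *)

Section RealLimits.
Context {T : Type} {F : (T -> Prop) -> Prop} {FF : Filter F}.

Lemma filterlim_Rplus_R (f g : T -> R) (a b : R) :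
  filterlim f F (locally a) -> filterlim g F (locally b) ->
  filterlim (fun x => f x + g x) F (locally (a + b)).
Proof.
  intros Hf Hg; apply (filterlim_comp_2 f g Rplus Hf Hg).
  apply (filterlim_plus (K := R_AbsRing) (V := R_NormedModule)).
Qed.

Lemma filterlim_Rmult_R (f g : T -> R) (a b : R) :
  filterlim f F (locally a) -> filterlim g F (locally b) ->
  filterlim (fun x => f x * g x) F (locally (a * b)).
Proof.
  intros Hf Hg; apply (filterlim_comp_2 f g Rmult Hf Hg).
  apply (filterlim_mult (K := R_AbsRing)).
Qed.

Lemma filterlim_comp_ex_derive (f : T -> R) (h : R -> R) (a : R) :
  filterlim f F (locally a) -> ex_derive h a ->
  filterlim (fun x => h (f x)) F (locally (h a)).
Proof.
  intros Hf Hh; apply (filterlim_comp _ _ _ f h _ _ _ Hf).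
  now apply (ex_derive_continuous h).
Qed.

(** Meant for [cusp_remainder], which is only shown to be bounded, not to converge. *)
Lemma filterlim_bounded_mult (b f : T -> R) :
  F (fun x => Rabs (b x) <= 1) -> filterlim f F (locally 0) ->
  filterlim (fun x => b x * f x) F (locally 0).
Proof.
  intros Hb Hf; apply filterlim_locally; intros eps.
  generalize (filter_and _ _ Hb (proj1 (filterlim_locally f 0) Hf eps)).
  apply filter_imp; intros x [H1 H2].
  change (Rabs (b x * f x - 0) < eps); change (Rabs (f x - 0) < eps) in H2.
  rewrite Rminus_0_r in *; rewrite Rabs_mult.
  apply Rle_lt_trans with (1 * Rabs (f x)); [|lra].
  apply Rmult_le_compat_r; [apply Rabs_pos|exact H1].
Qed.
End RealLimits.

Lemma at_right_0_lt (b : R) : 0 < b -> at_right 0 (fun w => 0 < w < b).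
Proof.
  intros Hb; exists (mkposreal b Hb); intros w Hw Hw0.
  apply Rabs_lt_between' in Hw; simpl in Hw; lra.
Qed.

Lemma filterlim_at_right_of_pos (f : R -> R) :
  filterlim f (at_right 0) (locally 0) -> at_right 0 (fun w => 0 < f w) ->
  filterlim f (at_right 0) (at_right 0).
Proof.
  intros Hf Hpos P HP; unfold filtermap.
  generalize (filter_and _ _ Hpos (Hf _ HP)); apply filter_imp.
  intros w [H1 H2]; auto.
Qed.


Lemma continuous_at_right (f : R -> R) (x : R) :
  continuous f x -> filterlim f (at_right x) (locally (f x)).
Proof.
  intros Hf P HP; apply filter_le_within; exact (Hf P HP).
Qed.

Definition cusp_ratio (w : R) : R := w * cusp_weight w / cusp_length w.

(** The number R for which G = w k (1 - k^2 / 2 + R k^4). *)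
Definition cusp_remainder (w : R) : R :=
  (/ cusp_ratio w - 1 + cusp_weight w ^ 2 / 2) / cusp_weight w ^ 4.

(** The bounds by [cusp_expansion] with a = 0 and a = 1 say that R lies between 0 and 1. *)
Lemma cusp_remainder_bound (w : R) : 0 < w < 1 -> Rabs (cusp_remainder w) <= 1.
Proof.
  intros Hw; assert (Hk := cusp_weight_pos w Hw).
  assert (HG := cusp_length_pos w Hw).
  assert (H1 := cusp_length_ge w Hw); assert (H2 := cusp_length_le w Hw).
  unfold cusp_expansion in *.
  set (k := cusp_weight w) in *; set (G := cusp_length w) in *.
  assert (Hwk : 0 < w * k) by (apply Rmult_lt_0_compat; lra).
  assert (Hk4 : 0 < w * k * k ^ 4) by (apply Rmult_lt_0_compat; [lra|now apply pow_lt]).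
  replace (cusp_remainder w) with ((G - w * k * (1 - k ^ 2 / 2)) / (w * k * k ^ 4)).
  - rewrite Rabs_right.
    + apply Rle_div_l; lra.
    + apply Rle_ge, Rdiv_le_0_compat; lra.
  - unfold cusp_remainder, cusp_ratio; fold k G; field; lra.
Qed.

Lemma cusp_weight_lim : filterlim cusp_weight (at_right 0) (locally 0).
Proof.
  rewrite <- (cusp_weight_nonpos 0) at 2 by lra.
  apply (continuous_at_right cusp_weight).
  apply cusp_weight_continuous; lra.
Qed.

Lemma cusp_weight_sqr_lim :
  filterlim (fun w => cusp_weight w ^ 2) (at_right 0) (locally 0).
Proof.
  replace 0 with (0 ^ 2) at 2 by ring.
  apply (filterlim_comp_ex_derive cusp_weight (fun k => k ^ 2) 0 cusp_weight_lim).
  auto_derive; trivial.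
Qed.

Lemma inv_cusp_weight_sqr_lim :
  filterlim (fun w => / cusp_weight w ^ 2) (at_right 0) (Rbar_locally p_infty).
Proof.
  apply (filterlim_comp _ _ _ (fun w => cusp_weight w ^ 2) Rinv _ (at_right 0));
    [|exact filterlim_Rinv_0_right].
  apply filterlim_at_right_of_pos; [exact cusp_weight_sqr_lim|].
  generalize (at_right_0_lt 1 Rlt_0_1); apply filter_imp; intros w Hw.
  now apply pow_lt, cusp_weight_pos.
Qed.

(** As / k^2 is the leading part of L, this is the leading part of ln L, expressed through k
    alone. *)
Definition cusp_loglog (w : R) : R := ln (/ cusp_weight w ^ 2).

Lemma cusp_loglog_lim :
  filterlim cusp_loglog (at_right 0) (Rbar_locally p_infty).
Proof.
  apply (filterlim_comp _ _ _ (fun w => / cusp_weight w ^ 2) ln _ _ _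
    inv_cusp_weight_sqr_lim is_lim_ln_p).
Qed.

Lemma inv_cusp_loglog_lim :
  filterlim (fun w => / cusp_loglog w) (at_right 0) (locally 0).
Proof.
  apply (filterlim_comp _ _ _ cusp_loglog Rinv _ _ _ cusp_loglog_lim).
  now apply (filterlim_Rbar_inv p_infty).
Qed.

Lemma cusp_weight_sqr_loglog_lim :
  filterlim (fun w => cusp_weight w ^ 2 * cusp_loglog w) (at_right 0) (locally 0).
Proof.
  apply filterlim_ext_loc with
    (fun w => ln (/ cusp_weight w ^ 2) / (/ cusp_weight w ^ 2)).
  - apply filter_forall; intros w; unfold cusp_loglog, Rdiv; rewrite Rinv_inv; ring.
  - apply (filterlim_comp _ _ _ (fun w => / cusp_weight w ^ 2) (fun y => ln y / y)
      _ _ _ inv_cusp_weight_sqr_lim is_lim_div_ln_p).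
Qed.

Lemma cusp_ratio_pos (w : R) : 0 < w < 1 -> 0 < cusp_ratio w.
Proof.
  intros Hw; unfold cusp_ratio.
  apply Rdiv_lt_0_compat; [|now apply cusp_length_pos].
  apply Rmult_lt_0_compat; [lra|now apply cusp_weight_pos].
Qed.

(** The reciprocal is 1 - k^2 / 2 + R k^4 with R bounded and k -> 0, so it tends to 1. *)
Lemma cusp_ratio_lim : filterlim cusp_ratio (at_right 0) (locally 1).
Proof.
  assert (H : filterlim (fun w => 1 + (-1 / 2) * cusp_weight w ^ 2 +
      cusp_remainder w * cusp_weight w ^ 2 * cusp_weight w ^ 2)
      (at_right 0) (locally (1 + (-1 / 2) * 0 + 0 * 0))).
  { assert (Hk := cusp_weight_sqr_lim).
    apply filterlim_Rplus_R; [apply filterlim_Rplus_R; [apply filterlim_const|]|].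
    - apply filterlim_Rmult_R; [apply filterlim_const|exact Hk].
    - apply filterlim_Rmult_R; [|exact Hk].
      apply filterlim_bounded_mult; [|exact Hk].
      generalize (at_right_0_lt 1 Rlt_0_1); apply filter_imp.
      exact cusp_remainder_bound. }
  replace (1 + (-1 / 2) * 0 + 0 * 0) with 1 in H by lra.
  apply (filterlim_comp_ex_derive _ Rinv) in H; [|auto_derive; lra].
  rewrite Rinv_1 in H; revert H; apply filterlim_ext_loc.
  generalize (at_right_0_lt 1 Rlt_0_1); apply filter_imp; intros w Hw.
  assert (Hk := cusp_weight_pos w Hw); assert (Hy := cusp_ratio_pos w Hw).
  rewrite <- (Rinv_inv (cusp_ratio w)); f_equal.
  unfold cusp_remainder; field; lra.
Qed.

(* Both logarithms are expanded from [cusp_length = w k / cusp_ratio] and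
   [/ k ^ 2 = - ln (w (2 - w))]. *)
Lemma cusp_log_eq (w : R) :
  0 < w < 1 ->
  cusp_log w =
    / cusp_weight w ^ 2 + cusp_loglog w / 2 + ln (cusp_ratio w) + ln (2 - w).
Proof.
  intros Hw; assert (Hk := cusp_weight_pos w Hw).
  assert (HG := cusp_length_pos w Hw).
  assert (HP : / cusp_weight w ^ 2 = - ln w - ln (2 - w)).
  { rewrite cusp_weight_sqr, Rinv_inv by easy.
    replace (1 - (1 - w) ^ 2) with (w * (2 - w)) by ring.
    rewrite ln_mult; lra. }
  assert (Hll : cusp_loglog w = - 2 * ln (cusp_weight w)).
  { unfold cusp_loglog; rewrite ln_Rinv by now apply pow_lt.
    replace (cusp_weight w ^ 2) with (cusp_weight w * cusp_weight w) by ring.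
    rewrite ln_mult; lra. }
  rewrite Hll, HP; unfold cusp_log, cusp_ratio, Rdiv.
  assert (0 < w * cusp_weight w) by (apply Rmult_lt_0_compat; lra).
  rewrite ln_mult, ln_Rinv, ln_mult; try lra.
  now apply Rinv_0_lt_compat.
Qed.

Lemma cusp_ln_terms_lim :
  filterlim (fun w => ln (cusp_ratio w) + ln (2 - w)) (at_right 0)
    (locally (ln 1 + ln (2 - 0))).
Proof.
  apply filterlim_Rplus_R.
  - apply (filterlim_comp_ex_derive cusp_ratio ln); [exact cusp_ratio_lim|].
    auto_derive; lra.
  - apply (filterlim_comp_ex_derive (fun w => w) (fun w => ln (2 - w))).
    + apply (continuous_at_right (fun w => w)), continuous_id.
    + auto_derive; lra.
Qed.

Definition cusp_log_ratio (w : R) : R := cusp_log w * cusp_weight w ^ 2.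

(** Multiplying [cusp_log_eq] by k^2 leaves 1 plus terms that vanish, since k^2 ln (/ k^2) -> 0. *)
Lemma cusp_log_ratio_lim : filterlim cusp_log_ratio (at_right 0) (locally 1).
Proof.
  assert (H : filterlim (fun w => 1 + 1 / 2 * (cusp_weight w ^ 2 * cusp_loglog w) +
      cusp_weight w ^ 2 * (ln (cusp_ratio w) + ln (2 - w)))
      (at_right 0) (locally (1 + 1 / 2 * 0 + 0 * (ln 1 + ln (2 - 0))))).
  { apply filterlim_Rplus_R; [apply filterlim_Rplus_R; [apply filterlim_const|]|].
    - apply filterlim_Rmult_R; [apply filterlim_const|].
      exact cusp_weight_sqr_loglog_lim.
    - apply filterlim_Rmult_R; [exact cusp_weight_sqr_lim|exact cusp_ln_terms_lim]. }
  replace (1 + 1 / 2 * 0 + 0 * (ln 1 + ln (2 - 0))) with 1 in H by ring.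
  revert H; apply filterlim_ext_loc.
  generalize (at_right_0_lt 1 Rlt_0_1); apply filter_imp; intros w Hw.
  assert (Hk := cusp_weight_pos w Hw).
  unfold cusp_log_ratio; rewrite cusp_log_eq by easy; field; lra.
Qed.

(** * The variable, the correction and the limit of their slope *)

Definition cusp_variable (w : R) : R := ln (cusp_log w) / cusp_log w.

Definition cusp_variable_derivative (w : R) : R :=
  (ln (cusp_log w) - 1) * cusp_weight w / (cusp_log w ^ 2 * cusp_length w).

Definition cusp_correction (w : R) : R :=
  w / (cusp_length w * sqrt (cusp_log w)) - 1.

(* The quotient of the derivatives of [cusp_correction] and [cusp_variable]. *)
Definition cusp_slope (w : R) : R :=
  cusp_log w * sqrt (cusp_log w) *
  (1 - cusp_ratio w + cusp_ratio w / (2 * cusp_log w)) /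
  (cusp_weight w * (ln (cusp_log w) - 1)).

Lemma cusp_variable_lim : filterlim cusp_variable (at_right 0) (locally 0).
Proof.
  apply (filterlim_comp _ _ _ cusp_log (fun y => ln y / y) _ (Rbar_locally p_infty));
    [|exact is_lim_div_ln_p].
  apply (filterlim_comp _ _ _ (fun w => ln (cusp_length w)) Ropp _
    (Rbar_locally m_infty)); [|exact (filterlim_Rbar_opp m_infty)].
  apply (filterlim_comp _ _ _ cusp_length ln _ (at_right 0)); [|exact is_lim_ln_0].
  apply filterlim_at_right_of_pos.
  - rewrite <- cusp_length_0 at 2.
    apply (continuous_at_right cusp_length).
    apply cusp_length_continuous; lra.
  - generalize (at_right_0_lt 1 Rlt_0_1); apply filter_imp, cusp_length_pos.
Qed.

Lemma sqrt_cusp_log_ratio (w : R) :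
  0 < w < 1 -> 0 < cusp_log w ->
  sqrt (cusp_log_ratio w) = sqrt (cusp_log w) * cusp_weight w.
Proof.
  intros Hw HL; assert (Hk := cusp_weight_pos w Hw).
  unfold cusp_log_ratio; rewrite sqrt_mult; [|lra|apply pow2_ge_0].
  rewrite sqrt_pow2; lra.
Qed.

(** Inserting k in numerator and denominator turns w / (G sqrt L) into [cusp_ratio] / sqrt
    ([cusp_log_ratio]), a quotient of two quantities tending to 1. *)
Lemma cusp_correction_lim : filterlim cusp_correction (at_right 0) (locally 0).
Proof.
  assert (H : filterlim (fun w => cusp_ratio w * / sqrt (cusp_log_ratio w) + -1)
    (at_right 0) (locally (1 * / sqrt 1 + -1))).
  { apply filterlim_Rplus_R; [|apply filterlim_const].
    apply filterlim_Rmult_R; [exact cusp_ratio_lim|].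
    apply (filterlim_comp_ex_derive cusp_log_ratio (fun m => / sqrt m));
      [exact cusp_log_ratio_lim|].
    auto_derive; rewrite sqrt_1; lra. }
  rewrite sqrt_1 in H; replace (1 * / 1 + -1) with 0 in H by field.
  revert H; apply filterlim_ext_loc.
  destruct cusp_log_large as [w0 [Hw0 HL]].
  generalize (at_right_0_lt w0 (proj1 Hw0)); apply filter_imp; intros w Hw.
  specialize (HL w Hw); assert (Hw1 : 0 < w < 1) by lra.
  rewrite sqrt_cusp_log_ratio by lra.
  assert (Hk := cusp_weight_pos w Hw1); assert (HG := cusp_length_pos w Hw1).
  assert (Hs : 0 < sqrt (cusp_log w)) by (apply sqrt_lt_R0; lra).
  unfold cusp_correction, cusp_ratio; field; lra.
Qed.

Lemma ln_cusp_log_gt_1 (w : R) : 3 < cusp_log w -> 1 < ln (cusp_log w).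
Proof.
  intros HL; rewrite <- (ln_exp 1).
  apply ln_increasing; [apply exp_pos|].
  generalize exp_le_3; lra.
Qed.

(* All the divergent factors are traded for [/ cusp_loglog w -> 0] by means of
   the exact identity [cusp_log_eq]. *)
Lemma cusp_slope_eq (w : R) :
  0 < w < 1 -> 3 < cusp_log w -> 0 < cusp_loglog w ->
  cusp_slope w =
    - cusp_ratio w * sqrt (cusp_log_ratio w) *
    (1 / 4 + 1 / 2 * ((ln (cusp_ratio w) + ln (2 - w)) * / cusp_loglog w) +
     - (cusp_log_ratio w * (cusp_remainder w * / cusp_loglog w))) *
    / (1 + ln (cusp_log_ratio w) * / cusp_loglog w + - / cusp_loglog w).
Proof.
  intros Hw HL HM.
  assert (Hk := cusp_weight_pos w Hw); assert (Hy := cusp_ratio_pos w Hw).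
  assert (Hln := ln_cusp_log_gt_1 w HL).
  assert (Hlnm : ln (cusp_log_ratio w) = ln (cusp_log w) - cusp_loglog w).
  { unfold cusp_log_ratio, cusp_loglog.
    rewrite ln_mult, ln_Rinv; try lra; try (apply pow_lt; lra). }
  (* Since 1 - y = y (- k^2 / 2 + R k^4) for y = [cusp_ratio w], the bracket of the slope times L is
     y ((1 - L k^2) / 2 + R L k^4). By [cusp_log_eq], 1 - L k^2 is - k^2 times half of [cusp_loglog]
     plus the bounded logarithms, whence the 1/4. *)
  assert (Hsum : ln (cusp_ratio w) + ln (2 - w) =
    cusp_log w - / cusp_weight w ^ 2 - cusp_loglog w / 2)
    by (rewrite (cusp_log_eq w Hw); lra).
  rewrite Hlnm, Hsum, sqrt_cusp_log_ratio by lra.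
  unfold cusp_slope, cusp_remainder, cusp_log_ratio.
  field; repeat split; lra.
Qed.

Lemma cusp_slope_lim : filterlim cusp_slope (at_right 0) (locally (-1 / 4)).
Proof.
  assert (Hj := inv_cusp_loglog_lim).
  assert (Hm := cusp_log_ratio_lim).
  assert (Hj1 : filterlim (fun w => - / cusp_loglog w) (at_right 0) (locally (- 0))).
  { apply (filterlim_comp_ex_derive _ Ropp 0 Hj); auto_derive; trivial. }
  (* Every term divided by [cusp_loglog] vanishes, so only 1/4 survives in the bracket and 1 in the
     denominator. *)
  assert (H : filterlim (fun w =>
    - cusp_ratio w * sqrt (cusp_log_ratio w) *
    (1 / 4 + 1 / 2 * ((ln (cusp_ratio w) + ln (2 - w)) * / cusp_loglog w) +
     - (cusp_log_ratio w * (cusp_remainder w * / cusp_loglog w))) *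
    / (1 + ln (cusp_log_ratio w) * / cusp_loglog w + - / cusp_loglog w))
    (at_right 0) (locally (- (1) * sqrt 1 *
      (1 / 4 + 1 / 2 * ((ln 1 + ln (2 - 0)) * 0) + - (1 * 0)) *
      / (1 + ln 1 * 0 + - 0)))).
  { apply filterlim_Rmult_R; [apply filterlim_Rmult_R; [apply filterlim_Rmult_R|]|].
    - apply (filterlim_comp_ex_derive cusp_ratio Ropp 1 cusp_ratio_lim).
      auto_derive; trivial.
    - apply (filterlim_comp_ex_derive cusp_log_ratio sqrt 1 Hm).
      auto_derive; lra.
    - apply filterlim_Rplus_R; [apply filterlim_Rplus_R; [apply filterlim_const|]|].
      + apply filterlim_Rmult_R; [apply filterlim_const|].
        apply filterlim_Rmult_R; [exact cusp_ln_terms_lim|exact Hj].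
      + apply (filterlim_comp_ex_derive _ Ropp); [|auto_derive; trivial].
        apply filterlim_Rmult_R; [exact Hm|].
        apply filterlim_bounded_mult; [|exact Hj].
        generalize (at_right_0_lt 1 Rlt_0_1); apply filter_imp.
        exact cusp_remainder_bound.
    - apply (filterlim_comp_ex_derive _ Rinv); [|auto_derive; rewrite ln_1; lra].
      apply filterlim_Rplus_R; [|exact Hj1].
      apply filterlim_Rplus_R; [apply filterlim_const|].
      apply filterlim_Rmult_R; [|exact Hj].
      apply (filterlim_comp_ex_derive cusp_log_ratio ln 1 Hm).
      auto_derive; lra. }
  rewrite sqrt_1, ln_1 in H.
  replace (- (1) * 1 * (1 / 4 + 1 / 2 * ((0 + ln (2 - 0)) * 0) + - (1 * 0)) *
    / (1 + 0 * 0 + - 0)) with (-1 / 4) in H by field.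
  revert H; apply filterlim_ext_loc.
  destruct cusp_log_large as [w0 [Hw0 HL]].
  assert (HM : at_right 0 (fun w => 0 < cusp_loglog w)).
  { apply (cusp_loglog_lim (fun y => 0 < y)); now exists 0. }
  generalize (filter_and _ _ (at_right_0_lt w0 (proj1 Hw0)) HM).
  apply filter_imp; intros w [Hw HMw]; symmetry; apply cusp_slope_eq;
    [lra|now apply HL|exact HMw].
Qed.

(** * Derivatives and conclusion *)

Lemma cusp_log_derive (w : R) :
  0 < w < 1 -> is_derive cusp_log w (- (cusp_weight w / cusp_length w)).
Proof.
  intros Hw; assert (HG := cusp_length_pos w Hw).
  assert (Hd : is_derive cusp_length w (cusp_weight w))
    by (apply cusp_length_derive; lra).
  assert (He : ex_derive cusp_length w) by (eexists; exact Hd).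
  unfold cusp_log; auto_derive; [now repeat (split; trivial)|].
  replace (Derive _ w) with (cusp_weight w)
    by (symmetry; now apply is_derive_unique).
  field; lra.
Qed.

Lemma cusp_variable_is_derive (w : R) :
  0 < w < 1 -> 0 < cusp_log w ->
  is_derive cusp_variable w (cusp_variable_derivative w).
Proof.
  intros Hw HL; assert (HG := cusp_length_pos w Hw).
  assert (Hd := cusp_log_derive w Hw).
  assert (He : ex_derive cusp_log w) by (eexists; exact Hd).
  unfold cusp_variable; auto_derive; [repeat (split; trivial); lra|].
  replace (Derive _ w) with (- (cusp_weight w / cusp_length w))
    by (symmetry; now apply is_derive_unique).
  unfold cusp_variable_derivative; field; lra.
Qed.

(** With y = [cusp_ratio w], the derivative is (1 - y + y / (2 L)) / (G sqrt L); dividing it by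
    [cusp_variable_derivative] gives [cusp_slope]. *)
Lemma cusp_correction_is_derive (w : R) :
  0 < w < 1 -> 3 < cusp_log w ->
  is_derive cusp_correction w (cusp_slope w * cusp_variable_derivative w).
Proof.
  intros Hw HL; assert (HG := cusp_length_pos w Hw).
  assert (Hk := cusp_weight_pos w Hw); assert (Hln := ln_cusp_log_gt_1 w HL).
  assert (Hs : 0 < sqrt (cusp_log w)) by (apply sqrt_lt_R0; lra).
  assert (Hd := cusp_log_derive w Hw).
  assert (HdG : is_derive cusp_length w (cusp_weight w))
    by (apply cusp_length_derive; lra).
  assert (He : ex_derive cusp_log w) by (eexists; exact Hd).
  assert (HeG : ex_derive cusp_length w) by (eexists; exact HdG).
  unfold cusp_correction; auto_derive.
  { repeat (split; trivial); try lra.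
    apply Rgt_not_eq, Rmult_lt_0_compat; lra. }
  replace (Derive _ w) with (cusp_weight w)
    by (symmetry; now apply is_derive_unique).
  replace (Derive _ w) with (- (cusp_weight w / cusp_length w))
    by (symmetry; now apply is_derive_unique).
  unfold cusp_variable_derivative, cusp_slope, cusp_ratio.
  (* Replacing L by the square of its root makes the identity rational in that root. *)
  assert (Hss : cusp_log w = sqrt (cusp_log w) * sqrt (cusp_log w))
    by (symmetry; apply sqrt_sqrt; lra).
  set (l := ln (cusp_log w)) in *; set (s := sqrt (cusp_log w)) in *.
  rewrite Hss.
  field; repeat split; lra.
Qed.

Lemma cusp_slope_continuous (w : R) :
  0 < w < 1 -> 3 < cusp_log w -> continuous cusp_slope w.
Proof.
  intros Hw HL; assert (HG := cusp_length_pos w Hw).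
  assert (Hk := cusp_weight_pos w Hw); assert (Hln := ln_cusp_log_gt_1 w HL).
  assert (He : ex_derive cusp_log w) by (eexists; now apply cusp_log_derive).
  assert (HeG : ex_derive cusp_length w)
    by (eexists; apply cusp_length_derive; lra).
  assert (Hek : ex_derive cusp_weight w) by (eexists; now apply cusp_weight_derive).
  apply (ex_derive_continuous cusp_slope).
  unfold cusp_slope, cusp_ratio; auto_derive.
  repeat (split; trivial); try lra.
  apply Rgt_not_eq, Rmult_lt_0_compat; lra.
Qed.

Theorem proposition3 (u_cusp : R -> R) (hu : cusped_soliton u_cusp) :
  exists f : R -> R, C1_bigO_0plus f /\
    exists eps : R, 0 < eps /\
      forall x : R, 0 < Rabs x < eps ->
        u_cusp x =
          1 - Rabs x * sqrt (ln (1 / Rabs x)) *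
              (1 + f (ln (ln (1 / Rabs x)) / ln (1 / Rabs x))).
Proof.
  destruct cusp_log_large as [w0 [Hw0 HL]].
  destruct (C1_reparametrization cusp_variable cusp_correction cusp_slope
    cusp_variable_derivative (-1 / 4) w0) as [f [Hf [w1 [Hw1 Hfw]]]].
  - lra.
  - exact cusp_variable_lim.
  - exact cusp_correction_lim.
  - exact cusp_slope_lim.
  - intros w Hw; specialize (HL w Hw); assert (Hw' : 0 < w < 1) by lra.
    split; [apply cusp_variable_is_derive; lra|].
    split; [|split; [now apply cusp_correction_is_derive|
      now apply cusp_slope_continuous]].
    assert (HG := cusp_length_pos w Hw'); assert (Hk := cusp_weight_pos w Hw').
    assert (Hln := ln_cusp_log_gt_1 w HL).
    apply Rdiv_lt_0_compat; apply Rmult_lt_0_compat; try lra; apply pow_lt; lra.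
  - exists f; split; [exact Hf|].
    pose (w2 := Rmin w0 w1).
    assert (Hw2 : 0 < w2 <= w0 /\ w2 <= w1).
    { unfold w2; generalize (Rmin_l w0 w1) (Rmin_r w0 w1); intros.
      split; [split; [apply Rmin_glb_lt; lra|lra]|lra]. }
    (* Since [cusp_length] is increasing, |x| < G(w2) forces 1 - u(x) < w2, where both the bound on
       L and the identity for [f] hold. *)
    exists (cusp_length w2); split; [apply cusp_length_pos; lra|].
    intros x [Hx0 Hx].
    destruct (cusped_soliton_length u_cusp x hu) as [Hw Hlen].
    { intros ->; rewrite Rabs_R0 in Hx0; lra. }
    set (w := 1 - u_cusp x) in *.
    assert (Hww : w < w2).
    { destruct (Rlt_le_dec w w2) as [H|[H|H]]; [easy| |].
      - apply cusp_length_increasing in H; lra.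
      - rewrite H in Hx; lra. }
    assert (HLw : 3 < cusp_log w) by (apply HL; lra).
    assert (HG := cusp_length_pos w Hw).
    assert (Hs : 0 < sqrt (cusp_log w)) by (apply sqrt_lt_R0; lra).
    replace (ln (1 / Rabs x)) with (cusp_log w).
    + change (ln (cusp_log w) / cusp_log w) with (cusp_variable w).
      rewrite Hfw, Hlen by lra.
      unfold cusp_correction; replace (u_cusp x) with (1 - w) by (unfold w; ring).
      field; lra.
    + rewrite Hlen; unfold Rdiv; rewrite Rmult_1_l, ln_Rinv by easy; reflexivity.
Qed.
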